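(* Let $X,Y$ be Banach $D$-modules and let $A$ be a Banach $D$-algebra. Let the maps $$M:X\to\mathcal{L}(D;X\to A),\qquad N:Y\to\mathcal{L}(D;Y\to A)$$ be integrable. The solution of the differential equation $$M(x)\circ dx+N(y)\circ dy=0$$ is the implicit function $$\int M(x)\circ dx+\int N(y)\circ dy=C.$$
   Context: $D$ is a complete commutative ring of characteristic $0$. $\mathcal{L}(D;X\to A)$ denotes the set of linear maps of the $D$-module $X$ into the $D$-algebra $A$ (likewise $\mathcal{L}(D;Y\to A)$), and $\circ$ denotes the action of a linear map on its argument. The derivative $\frac{df(x)}{dx}\in\mathcal{L}(D;X\to A)$ of a map $f:X\to A$ is the linear map whose value $\frac{df(x)}{dx}\circ dx$ is the differential of $f$ at $x$. A map $g:X\to\mathcal{L}(D;X\to A)$ is called integrable if there exists a map $f:X\to A$ such that $\frac{df(x)}{dx}=g(x)$; then one writes $f(x)=\int g(x)\circ dx$ and $f$ is called an indefinite integral of $g$ (similarly for $Y$). A differential equation of the form $M(x)\circ dx+N(y)\circ dy=0$, with $M,N$ as in the claim, is called a differential equation with separated variables. $C$ is a constant in $A$.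
   Formalization: ''Characteristic 0'' is taken to mean that the rationals with their usual absolute value embed isometrically in D (the claim fails over the integers or p-adic numbers), derivatives are required to be continuous linear maps, and solutions y(x) are considered on connected open sets. *)

(* Defs.v *)
(* MathComp / MathComp-Analysis *)
From HB Require Import structures.
From mathcomp Require Import all_boot all_order all_algebra.
From mathcomp Require Import all_classical reals topology normedtype.

Set Implicit Arguments.
Unset Strict Implicit.
Unset Printing Implicit Defensive.

Import Order.TTheory GRing.Theory Num.Theory.
Import numFieldNormedType.Exports.

Local Open Scope classical_set_scope.
Local Open Scope ring_scope.

(* The norms of rings and modules take their values in R.  The last field says
   that Cauchy sequences of D converge.  A multiplicative norm,
   |a b| = |a| |b|, is a particular case. *)
HB.mixin Record ComNzRing_hasCompleteNorm (R : realType) D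
    of GRing.ComNzRing D := {
  rnorm : D -> R;
  rnorm_ge0 : forall a, 0 <= rnorm a;
  rnorm_eq0 : forall a, rnorm a = 0 <-> a = 0;
  rnormN : forall a, rnorm (- a) = rnorm a;
  rnormD : forall a b, rnorm (a + b) <= rnorm a + rnorm b;
  rnormM : forall a b, rnorm (a * b) <= rnorm a * rnorm b;
  rnorm_complete : forall u : nat -> D,
    (forall e : R, 0 < e -> exists N, forall m n,
       (N <= m)%N -> (N <= n)%N -> rnorm (u m - u n) < e) ->
    exists l, (fun n => rnorm (u n - l)) @ \oo --> (0 : R)
}.

#[short(type="completeComRingType")]
HB.structure Definition CompleteComRing (R : realType) :=
  {D of GRing.ComNzRing D & ComNzRing_hasCompleteNorm R D}.

(* D has characteristic 0, in the sense used for complete normed rings: the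
   field of rational numbers, with its usual absolute value, embeds in D (so
   that D, being complete, contains the real numbers).  Without this, for
   instance over the integers or the p-adic numbers, either derivatives are not
   unique or there are nonconstant maps with zero derivative. *)
Definition characteristic0 (R : realType) (D : completeComRingType R) : Prop :=
  exists i : {rmorphism rat -> D}, forall q : rat, rnorm (i q) = `|ratr q : R|.

(* GRing.Lmodule over D cannot be joined with the library's normed groups over
   R <> D (it would clash with NormedModule), hence the explicit scalar
   multiplication.  The axiom normrMn of normed groups, `|x *+ n| = `|x| *+ n,
   is no restriction here: it follows from the other axioms when D has
   characteristic 0 in the above sense.  The last field is that of the mixin
   Uniform_isComplete. *)
HB.mixin Record NormedZmod_isBanachModule (R : realType)
    (D : completeComRingType R) X of PseudoMetricNormedZmod R X := {
  scal : D -> X -> X;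
  scalDl : forall (a b : D) (x : X), scal (a + b) x = scal a x + scal b x;
  scalDr : forall (a : D) (x y : X), scal a (x + y) = scal a x + scal a y;
  scalA : forall (a b : D) (x : X), scal a (scal b x) = scal (a * b) x;
  scal1 : forall x : X, scal 1 x = x;
  norm_scal : forall (a : D) (x : X), `|scal a x| <= rnorm a * `|x|;
  banach_complete :
    forall F : set_system X, ProperFilter F -> cauchy F -> cvg F
}.

#[short(type="banachModType")]
HB.structure Definition BanachModule (R : realType)
    (D : completeComRingType R) :=
  {X of PseudoMetricNormedZmod R X & NormedZmod_isBanachModule R D X}.

(* A D-algebra is a D-module with a D-bilinear product; neither associativity
   nor a unit is assumed. *)
HB.mixin Record BanachModule_isBanachAlgebra (R : realType)
    (D : completeComRingType R) A of BanachModule R D A := {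
  amul : A -> A -> A;
  amulDl : forall a b c : A, amul (a + b) c = amul a c + amul b c;
  amulDr : forall a b c : A, amul a (b + c) = amul a b + amul a c;
  amulZl : forall (d : D) (a b : A), amul (scal d a) b = scal d (amul a b);
  amulZr : forall (d : D) (a b : A), amul a (scal d b) = scal d (amul a b);
  norm_amul : forall a b : A, `|amul a b| <= `|a| * `|b| :> R
}.

#[short(type="banachAlgType")]
HB.structure Definition BanachAlgebra (R : realType)
    (D : completeComRingType R) :=
  {A of BanachModule R D A & BanachModule_isBanachAlgebra R D A}.

(* L(D; X -> Z) *)
Record linear_map (R : realType) (D : completeComRingType R)
    (X Z : banachModType D) := LinearMap {
  linear_map_fun :> X -> Z;
  linear_mapD : forall x y : X,
    linear_map_fun (x + y) = linear_map_fun x + linear_map_fun y;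
  linear_mapZ : forall (d : D) (x : X),
    linear_map_fun (scal d x) = scal d (linear_map_fun x)
}.

Section Calculus.
Variables (R : realType) (D : completeComRingType R).

(* L = df(x)/dx, i.e. f (x + h) - f x = L h + o(h).  The continuity of L is part
   of the definition, since algebraic linearity does not imply it. *)
Definition is_derivative (X Z : banachModType D) (f : X -> Z) (x : X)
    (L : linear_map X Z) : Prop :=
  continuous L /\
  (fun h : X => `|f (x + h) - f x - L h| / `|h|) @ 0^' --> (0 : R).

Definition differentiable_at (X Z : banachModType D) (f : X -> Z) (x : X) :=
  exists L : linear_map X Z, is_derivative f x L.

Definition indefinite_integral (X : banachModType D) (A : banachAlgType D)
    (g : X -> linear_map X A) (f : X -> A) : Prop :=
  forall x, is_derivative f x (g x).

Definition integrable (X : banachModType D) (A : banachAlgType D)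
    (g : X -> linear_map X A) : Prop :=
  exists f : X -> A, indefinite_integral g f.

(* The function y = y(x) solves M(x) o dx + N(y) o dy = 0 on U, where
   dy = (dy(x)/dx) o dx. *)
Definition solves_separated (X Y : banachModType D) (A : banachAlgType D)
    (M : X -> linear_map X A) (N : Y -> linear_map Y A)
    (U : set X) (y : X -> Y) : Prop :=
  forall x, U x -> exists2 y' : linear_map X Y, is_derivative y x y' &
    forall dx : X, M x dx + N (y x) (y' dx) = 0.

End Calculus.

(* Main.v *)
(* By the chain rule, F + G o y has derivative M x + N (y x) o y'(x) at x.  If y
   solves the equation, this derivative vanishes on U; a map whose derivative
   vanishes is constant on balls (by bisection), hence on the connected open set
   U.  Conversely, if F + G o y is constant on U, its derivative is also 0, and
   derivatives are unique because a vector v is 2^n times a vector of norm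
   |v| / 2^n. *)
Require Import Defs.
From HB Require Import structures.
From mathcomp Require Import all_boot all_order all_algebra ring lra.
From mathcomp Require Import all_classical reals topology normedtype.

Set Implicit Arguments.
Unset Strict Implicit.
Unset Printing Implicit Defensive.

Import Order.TTheory GRing.Theory Num.Theory.
Import numFieldNormedType.Exports.

Local Open Scope classical_set_scope.
Local Open Scope ring_scope.

Section Differentiation.
Context (R : realType) (D : completeComRingType R).
Implicit Types X Y Z : banachModType D.

(** * Linear maps between D-modules *)

Lemma linear_map0 X Z (L : linear_map X Z) : L 0 = 0.
Proof. by apply: (addrI (L 0)); rewrite -linear_mapD !addr0. Qed.

Lemma linear_mapMn X Z (L : linear_map X Z) x n : L (x *+ n) = L x *+ n.
Proof.
by elim: n => [|n IH]; rewrite ?mulr0n ?linear_map0// !mulrS linear_mapD IH.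
Qed.

Lemma scal0r X (d : D) : scal d (0 : X) = 0.
Proof. by apply: (addrI (scal d 0)); rewrite -scalDr !addr0. Qed.

Definition zero_linear_map X Z : linear_map X Z.
Proof.
by exists (fun=> 0) => [x y|d x]; rewrite ?addr0 ?scal0r.
Defined.

Definition add_linear_map X Z (L L' : linear_map X Z) : linear_map X Z.
Proof.
exists (fun x => L x + L' x) => [x y|d x].
  by rewrite !linear_mapD addrACA.
by rewrite !linear_mapZ scalDr.
Defined.

Definition comp_linear_map X Y Z (L : linear_map Y Z) (L' : linear_map X Y) :
  linear_map X Z.
Proof.
by exists (L \o L') => [x y|d x] /=; rewrite ?linear_mapD ?linear_mapZ.
Defined.

(** * Estimates for the derivative, sum rule and chain rule *)

(** At [h = 0] both sides of the estimate vanish, so the punctured neighbourhood can be replaced by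
    a full one and the division disappears. *)
Lemma is_derivativeP X Z (f : X -> Z) x (L : linear_map X Z) :
  is_derivative f x L <-> continuous L /\ forall e : R, 0 < e ->
    \forall h \near 0, `|f (x + h) - f x - L h| <= e * `|h|.
Proof.
split=> -[cL dL]; split=> //.
  move=> e e0; move/cvgr0_norm_lt: dL => /(_ e e0).
  rewrite near_withinE => /nbhs_norm0P[d /= d0 Hd].
  apply/nbhs_norm0P; exists d => //= h /= hd.
  have [->|h0] := eqVneq h 0.
    by rewrite addr0 linear_map0 subrr subr0 !normr0 mulr0.
  have := Hd h hd h0; rewrite normrM normfV !normr_id ltr_pdivrMr ?normr_gt0//.
  exact: ltW.
apply/cvgr0Pnorm_lt => e e0; rewrite near_withinE.
have e20 : 0 < e / 2 by rewrite divr_gt0.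
apply: filterS (dL _ e20) => h Hh h0.
rewrite normrM normfV !normr_id ltr_pdivrMr ?normr_gt0//.
by rewrite (le_lt_trans Hh)// ltr_pM2r ?normr_gt0//; lra.
Qed.

(* Only multiples of h by natural numbers are available: the largest multiple
   that stays in the ball of radius d is used. *)
Lemma continuous_linear_bound X Z (L : linear_map X Z) :
  continuous L ->
  exists2 K : R, 0 < K & \forall h \near 0, `|L h| <= K * `|h|.
Proof.
move=> /(_ 0); rewrite /continuous_at linear_map0.
move=> /cvgr0_norm_lt /(_ 1 ltr01) /nbhs_norm0P[d /= d0 Hd].
exists (2 / d); first by rewrite divr_gt0.
apply/nbhs_norm0P; exists (d / 2); first by rewrite /= divr_gt0.
move=> h /= hd.
have [->|h0] := eqVneq h 0; first by rewrite linear_map0 !normr0 mulr0.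
have nh0 : 0 < `|h| by rewrite normr_gt0.
(* The bound |h| < d / 2 forces [c > 1]. With [n] the integer part of [c], one has c < n + 1 <= c +
   1 < 2 c: the multiple (n + 1) h stays in the ball of radius d = 2 c |h|, and its image, of norm
   below 1, bounds [L h]. *)
pose c := d / 2 / `|h|.
have dc : d = 2 * c * `|h| by rewrite -mulrA mulfVK ?gt_eqF//; lra.
have c1 : 1 < c by rewrite ltr_pdivlMr ?mul1r.
clearbody c.
have /andP[cl cu] := truncn_itv (ltW (lt_trans ltr01 c1)).
set n := Num.truncn c in cl cu.
have Hh : `|h *+ n.+1| < d.
  by rewrite normrMn -mulr_natl dc ltr_pM2r// -natr1; lra.
have cL1 : c * `|L h| <= 1.
  apply: ltW; apply: le_lt_trans (Hd _ Hh); rewrite linear_mapMn normrMn.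
  by rewrite -[leRHS]mulr_natl ler_wpM2r// ltW.
rewrite mulrAC ler_pdivlMr// dc.
have -> : `|L h| * (2 * c * `|h|) = 2 * `|h| * (c * `|L h|) by ring.
by rewrite ler_piMr// mulr_ge0.
Qed.

Lemma continuous_add_linear_map X Z (L L' : linear_map X Z) :
  continuous L -> continuous L' -> continuous (add_linear_map L L').
Proof. by move=> cL cL' x; apply: cvgD; [exact: cL|exact: cL']. Qed.

Lemma is_derivative_add X Z (f g : X -> Z) x (L L' : linear_map X Z) :
  is_derivative f x L -> is_derivative g x L' ->
  is_derivative (fun t => f t + g t) x (add_linear_map L L').
Proof.
move=> /is_derivativeP[cL dL] /is_derivativeP[cL' dL'].
apply/is_derivativeP; split=> [|e e0]; first exact: continuous_add_linear_map.
have e20 : 0 < e / 2 by rewrite divr_gt0.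
apply: filterS2 (dL _ e20) (dL' _ e20) => h Hf Hg /=.
have -> : f (x + h) + g (x + h) - (f x + g x) - (L h + L' h) =
  (f (x + h) - f x - L h) + (g (x + h) - g x - L' h).
  by rewrite [RHS]addrACA -opprD [in RHS]addrACA -opprD.
by rewrite (le_trans (ler_normD _ _))// [e in leRHS]splitr mulrDl lerD.
Qed.

Lemma is_derivative_comp X Y Z (g : Y -> Z) (f : X -> Y) x
    (N : linear_map Y Z) (L : linear_map X Y) :
  is_derivative f x L -> is_derivative g (f x) N ->
  is_derivative (g \o f) x (comp_linear_map N L).
Proof.
move=> /is_derivativeP[cL dL] /is_derivativeP[cN dN].
apply/is_derivativeP; split=> [t|e e0].
  by apply: continuous_comp; [exact: cL|exact: cN].
have [K K0 LK] := continuous_linear_bound cL.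
have [K' K'0 /nbhs_norm0P[d' /= d'0 NK']] := continuous_linear_bound cN.
(* The error of [g] at the increment [k] of [f] and the image under [N] of the remainder [r] of [f]
   get [e / 2] each, divided by the bounds [K + 1] for the increment and [K'] for [N]. *)
have e10 : 0 < e / 2 / (K + 1) by rewrite !divr_gt0//; lra.
have e20 : 0 < e / 2 / K' by rewrite !divr_gt0.
have /nbhs_norm0P[d /= d0 Hd] := dN _ e10.
have s0 : 0 < Num.min d d' / (K + 1).
  by rewrite divr_gt0 ?lt_min ?d0 ?d'0//; lra.
have small : \forall h \near (0 : X), `|h| < Num.min d d' / (K + 1).
  by apply/nbhs_norm0P; exists (Num.min d d' / (K + 1)).
near=> h.
have hs : `|h| < Num.min d d' / (K + 1) by near: h.
(* The constant 1 yields |k| <= (K + 1) |h|, and |r| <= |h| puts [r] in the ball of radius [d']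
   where [K'] bounds [N]. *)
have H1 : `|f (x + h) - f x - L h| <= 1 * `|h| by near: h; apply: dL.
have H2 : `|f (x + h) - f x - L h| <= e / 2 / K' * `|h| by near: h; apply: dL.
have H3 : `|L h| <= K * `|h| by near: h.
set r := f (x + h) - f x - L h in H1 H2.
set k := f (x + h) - f x.
have kr : k = L h + r by rewrite addrC subrK.
have kle : `|k| <= (K + 1) * `|h|.
  by rewrite kr (le_trans (ler_normD _ _))//; lra.
have := hs; rewrite ltr_pdivlMr ?lt_min; last lra.
move=> /andP[hd hd'].
have kd : `|k| < d by rewrite (le_lt_trans kle)// mulrC.
have rd' : `|r| < d' by have := normr_ge0 h; nra.
have -> : (g \o f) (x + h) - (g \o f) x - comp_linear_map N L h =
    (g (f x + k) - g (f x) - N k) + N r.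
  by rewrite /= [f x + k]addrC subrK kr linear_mapD opprD addrA subrK.
have Hk := Hd _ kd; have Hr := NK' _ rd'; rewrite /= in Hk Hr.
rewrite (le_trans (ler_normD _ _))//.
have A1 : e / 2 / (K + 1) * `|k| <= e / 2 * `|h|.
  by rewrite mulrAC ler_pdivrMr; [have := divr_gt0 e0 (ltr0Sn R 1); nra|lra].
have A2 : K' * `|r| <= e / 2 * `|h|.
  by rewrite mulrC -ler_pdivlMr// mulrAC.
lra.
Unshelve. all: by end_near. Qed.

(** [is_derivative] depends on the linear map only through its underlying function, so pointwise
    equality can replace equality of records. *)
Lemma is_derivative_ext X Z (f : X -> Z) x (L L' : linear_map X Z) :
  L =1 L' -> is_derivative f x L -> is_derivative f x L'.
Proof. by rewrite /is_derivative => /funext ->. Qed.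

Lemma is_derivative_near_cst X Z (f : X -> Z) (c : Z) x :
  (\forall t \near x, f t = c) -> is_derivative f x (zero_linear_map X Z).
Proof.
move=> fc; apply/is_derivativeP; split=> [t|e e0]; first exact: cvg_cst.
have -> : f x = c by exact: nbhs_singleton fc.
move/nbhs0P: fc; apply: filterS => h -> /=.
by rewrite subrr subr0 normr0 mulr_ge0// ltW.
Qed.

(** * Halving vectors and uniqueness of the derivative *)

Lemma half_exists : characteristic0 D -> exists s : D, s + s = 1.
Proof.
move=> [i _]; exists (i 2^-1); rewrite -rmorphD -(rmorph1 i); congr (i _).
Qed.

Section Half.
Context (s : D) (ss : s + s = 1).

Lemma scal_halfD X (v : X) : scal s v + scal s v = v.
Proof. by rewrite -scalDl ss scal1. Qed.

(** [norm_scal] gives only an inequality; equality comes from [normrMn] applied to [scal s v *+ 2],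
    which is [v]. *)
Lemma norm_scal_half X (v : X) : `|scal s v| = `|v| / 2.
Proof.
have : `|scal s v *+ 2| = `|v| by rewrite mulr2n scal_halfD.
by rewrite normrMn mulr2n; lra.
Qed.

End Half.

Lemma exists_div_exp2_lt (a e : R) : 0 < e -> exists n, a / 2 ^+ n < e.
Proof.
move=> e0; exists (Num.bound (a / e)).
rewrite ltr_pdivrMr ?exprn_gt0// mulrC -ltr_pdivrMr//.
have [ae|ae] := ltP (a / e) 0; first by rewrite (lt_le_trans ae)// exprn_ge0.
apply: lt_trans (archi_boundP ae) _.
by rewrite -natrX ltr_nat ltn_expl.
Qed.

Lemma derivative_unique X Z (f : X -> Z) x (L L' : linear_map X Z) :
  characteristic0 D ->
  is_derivative f x L -> is_derivative f x L' -> L =1 L'.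
Proof.
move=> /half_exists[s ss] /is_derivativeP[_ dL] /is_derivativeP[_ dL'] v.
apply/eqP; rewrite -subr_eq0 -normr_eq0 eq_le normr_ge0 andbT.
apply/ler_addgt0Pr => e e0; rewrite add0r.
(* Two errors [a] add up to e / (|v| + 1), which times |v| is at most [e]; the 1 covers [v = 0]. *)
pose a := e / (`|v| + 1) / 2.
have v1 : 0 < `|v| + 1 by rewrite ltr_wpDl.
have a0 : 0 < a by rewrite !divr_gt0.
have /nbhs_norm0P[d /= d0 Hd] :
    \forall h \near 0, `|L h - L' h| <= e / (`|v| + 1) * `|h|.
  apply: filterS2 (dL _ a0) (dL' _ a0) => h Hh Hh'.
  have -> : L h - L' h = (f (x + h) - f x - L' h) - (f (x + h) - f x - L h).
    by rewrite opprB [RHS]addrC addrA subrK.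
  rewrite (le_trans (ler_normB _ _))//.
  have -> : e / (`|v| + 1) = a + a by rewrite -splitr.
  lra.
have [n nd] := exists_div_exp2_lt `|v| d0.
have scale k : exists2 w : X, w *+ 2 ^ k = v & `|w| = `|v| / 2 ^+ k.
  elim: k => [|k [w wv nw]]; first by exists v; rewrite ?expr0 ?divr1.
  exists (scal s w).
    by rewrite expnS mulrnA mulr2n scal_halfD.
  by rewrite norm_scal_half// nw exprS invfM; lra.
have [w wv nw] := scale n.
have := Hd w; rewrite /= nw => /(_ nd) Lw.
(* By additivity the error at [v] is 2^n times the one at [w], which cancels the denominator of
   |w|. *)
rewrite -wv !linear_mapMn -mulrnBl normrMn -[leLHS]mulr_natr natrX.
rewrite -ler_pdivlMr ?exprn_gt0// (le_trans Lw)//.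
rewrite mulrA ler_pM2r ?invr_gt0 ?exprn_gt0//.
by rewrite mulrAC ler_pdivrMr// ler_pM2l// lerDl.
Qed.

(** * Maps with zero derivative *)

(* Bisect [x, b] forever, keeping a half on which the increment of f is at least
   half of the previous one, and use the zero derivative at the limit point.
   This needs only the scalar 1/2, not an action of the reals on X. *)
Lemma zero_derivative_eq X Z (f : X -> Z) x b :
  characteristic0 D ->
  (forall c, `|c - x| <= `|b - x| -> is_derivative f c (zero_linear_map X Z)) ->
  f b = f x.
Proof.
move=> /half_exists[s ss] df.
pose mid (p : X * X) := p.1 + scal s (p.2 - p.1).
pose step (p : X * X) := if `|f p.2 - f p.1| / 2 <= `|f (mid p) - f p.1|
  then (p.1, mid p) else (mid p, p.2).
have stepP p : [/\ `|(step p).2 - (step p).1| = `|p.2 - p.1| / 2,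
    `|f p.2 - f p.1| / 2 <= `|f (step p).2 - f (step p).1| &
    `|(step p).1 - p.1| <= `|p.2 - p.1| / 2].
  have mid1 : mid p - p.1 = scal s (p.2 - p.1) by rewrite addrC addKr.
  have mid2 : p.2 - mid p = scal s (p.2 - p.1).
    by rewrite opprD addrA -{1}(scal_halfD ss (p.2 - p.1)) addrK.
  rewrite /step; case: ifPn => [le_half|]; last rewrite -ltNge => lt_half /=.
    by split; rewrite /= ?mid1 ?norm_scal_half// subrr normr0 divr_ge0.
  split; rewrite ?mid1 ?mid2 ?norm_scal_half//.
  (* If the first half carries less than half of the increment, the second carries more. *)
  have : f p.2 - f p.1 = (f p.2 - f (mid p)) + (f (mid p) - f p.1).
    by rewrite addrA subrK.
  have := ler_normD (f p.2 - f (mid p)) (f (mid p) - f p.1).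
  by move=> + E; rewrite -E; lra.
pose p n := iter n step (x, b).
pose u n := (p n).1; pose v n := (p n).2.
set l := `|b - x| in df *.
have uv n : `|v n - u n| = l / 2 ^+ n.
  elim: n => [|n IH]; first by rewrite expr0 divr1.
  have [+ _ _] := stepP (p n); rewrite -/(p n.+1) => ->.
  by rewrite -/(v n) -/(u n) IH exprS invfM; lra.
have fuv n : `|f b - f x| / 2 ^+ n <= `|f (v n) - f (u n)|.
  elim: n => [|n IH]; first by rewrite expr0 divr1.
  have [_ + _] := stepP (p n); apply: le_trans.
  by rewrite exprSr invfM mulrA ler_pM2r ?invr_gt0.
have uS n : `|u n.+1 - u n| <= l / 2 ^+ n / 2.
  by have [_ _] := stepP (p n); rewrite -/(v n) -/(u n) uv.
(* This is the geometric sum of the step lengths; the subtracted term lets the induction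
   telescope. *)
have udist n k : `|u (k + n)%N - u n| <= l / 2 ^+ n - l / 2 ^+ (k + n).
  elim: k => [|k IH]; first by rewrite !subrr normr0.
  rewrite addSn (le_trans (ler_distD (u (k + n)%N) _ _))//.
  have := uS (k + n)%N; rewrite [2 ^+ _.+1]exprS invfM; lra.
have pow_ge0 n : 0 <= l / 2 ^+ n by rewrite -uv.
have udist_le n m : (n <= m)%N -> `|u m - u n| <= l / 2 ^+ n.
  by move=> /subnK <-; rewrite (le_trans (udist _ _))// gerBl.
have /cvg_ex[c /= uc] : cvg (u @ \oo).
  apply: banach_complete; apply: cauchy_exP => e e0.
  have [n ne] := exists_div_exp2_lt l e0.
  exists (u n); exists n => // m /= nm.
  by rewrite -ball_normE /= distrC (le_lt_trans (udist_le _ _ nm)).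
have cu n : `|c - u n| <= l / 2 ^+ n.
  apply/ler_addgt0Pr => e e0.
  have [N _ HN] := cvgr_dist_lt _ _ uc e e0.
  have := HN (maxn N n) (leq_maxl _ _) => /= cm.
  rewrite (le_trans (ler_distD (u (maxn N n)) _ _))// addrC lerD//.
    by rewrite udist_le ?leq_maxr.
  exact: ltW.
have cv n : `|c - v n| <= 2 * (l / 2 ^+ n).
  rewrite (le_trans (ler_distD (u n) _ _))// [`|u n - _|]distrC uv.
  by have := cu n; lra.
(* The limit [c] lies in the closed ball where [f] is known to have zero derivative. *)
have cx : `|c - x| <= l by have := cu 0%N; rewrite expr0 divr1.
have /is_derivativeP[_ dc] := df _ cx.
apply/eqP; rewrite -subr_eq0 -normr_eq0 eq_le normr_ge0 andbT.
apply/ler_addgt0Pr => e e0; rewrite add0r.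
(* The endpoints [u n] and [v n] lie within [l / 2 ^+ n] and twice that of [c], whence the 3; the 1
   keeps the denominator positive if [l = 0]. *)
have l1 : 0 < 3 * l + 1 by rewrite ltr_wpDl// mulr_ge0 ?normr_ge0.
pose e' := e / (3 * l + 1).
have e'0 : 0 < e' by rewrite divr_gt0.
have /nbhs_norm0P[d /= d0 Hd] := dc _ e'0.
have [n nd] := exists_div_exp2_lt (2 * l) d0.
have {}Hd w : `|c - w| <= 2 * (l / 2 ^+ n) ->
    `|f w - f c| <= e' * `|c - w|.
  move=> cw; have := Hd (w - c); rewrite /= distrC subrKC subr0.
  by apply; rewrite (le_lt_trans cw)// mulrA.
have Hu : `|f (u n) - f c| <= e' * (l / 2 ^+ n).
  rewrite (le_trans (Hd _ _)) ?ler_pM2l//.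
  by have := cu n; have := pow_ge0 n; lra.
have Hv : `|f (v n) - f c| <= e' * (2 * (l / 2 ^+ n)).
  by rewrite (le_trans (Hd _ (cv n)))// ler_pM2l.
(* The lower bound [fuv] decays like 2^-n, as does the upper bound, so the powers of 2 cancel. *)
have : `|f b - f x| / 2 ^+ n <= e' * (3 * l) / 2 ^+ n.
  rewrite (le_trans (fuv n))// (le_trans (ler_distD (f c) _ _))//.
  rewrite [`|f c - _|]distrC; lra.
rewrite ler_pM2r ?invr_gt0 ?exprn_gt0// => /le_trans; apply.
by rewrite /e' mulrAC ler_pdivrMr// ler_pM2l// lerDl.
Qed.

(** Since [f] is locally constant, each level set is open and closed in [U], and a nonempty one is
    all of the connected set [U]. *)
Lemma zero_derivative_connected X Z (f : X -> Z) (U : set X) :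
  characteristic0 D -> open U -> connected U ->
  (forall x, U x -> is_derivative f x (zero_linear_map X Z)) ->
  exists C, forall x, U x -> f x = C.
Proof.
move=> charD oU cU df.
have [[x0 Ux0]|U0] := pselect (U !=set0); last first.
  by exists 0 => x Ux; exfalso; apply: U0; exists x.
have fcst x : U x -> \forall t \near x, U t /\ f t = f x.
  move=> Ux; have /nbhs_normP[d /= d0 Ud] : nbhs x U.
    by move: oU; rewrite openE; apply.
  apply/nbhs_normP; exists d => // t /= td; split; first exact: Ud.
  apply: zero_derivative_eq => // c cx; apply/df/Ud => /=.
  by rewrite distrC (le_lt_trans cx)// distrC.
(* An arbitrary [P] covers both uses: a singleton for openness of the level set, its complement for
   closedness. *)
have level_open (P : set Z) : open (U `&` f @^-1` P).
  rewrite openE => x [Ux Px]; apply: filterS (fcst _ Ux) => t [Ut ft].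
  by split=> //=; rewrite ft.
exists (f x0) => x Ux.
suff UE : U `&` f @^-1` [set f x0] = U.
  by have : U x := Ux; rewrite -{1}UE => -[].
apply: cU; first by exists x0.
  exists (U `&` f @^-1` [set f x0]); first exact: level_open.
  by rewrite setIA setIid.
exists (~` (U `&` f @^-1` (~` [set f x0]))).
  by rewrite closedC; exact: level_open.
apply/seteqP; split=> t /=; first by move=> [Ut ft]; split=> // -[].
by move=> [Ut nt]; split=> //; apply: contrapT => ft; apply: nt.
Qed.

End Differentiation.

(** * Equivalence of the equation and its implicit solution *)

Theorem theorem7p1p1 (R : realType) (D : completeComRingType R)
    (charD : characteristic0 D)
    (X Y : banachModType D) (A : banachAlgType D)
    (M : X -> linear_map X A) (N : Y -> linear_map Y A)
    (intM : integrable M) (intN : integrable N)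
    (F : X -> A) (G : Y -> A)
    (FM : indefinite_integral M F) (GN : indefinite_integral N G)
    (U : set X) (openU : open U) (connectedU : connected U) (y : X -> Y) :
  solves_separated M N U y <->
  (forall x, U x -> differentiable_at y x) /\
  exists C : A, forall x, U x -> F x + G (y x) = C.
Proof.
have dFG x (y' : linear_map X Y) : is_derivative y x y' ->
    is_derivative (fun t => F t + G (y t)) x
      (add_linear_map (M x) (comp_linear_map (N (y x)) y')).
  move=> dy; apply: is_derivative_add; first exact: FM.
  exact: is_derivative_comp (GN _).
split=> [sol|[dy [C FGC]] x Ux].
  split=> [x /sol[y' dy _]|]; first by exists y'.
  apply: zero_derivative_connected => // x /sol[y' dy eq0].
  (* The equation says that the derivative given by the chain rule is pointwise zero. *)
  exact: is_derivative_ext (dFG _ _ dy).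
have [y' y'P] := dy x Ux; exists y' => // dx.
(* Openness of [U] makes the sum constant near [x], so zero and the chain rule expression are both
   its derivative there. *)
have cst0 : is_derivative (fun t => F t + G (y t)) x (zero_linear_map X A).
  apply: (@is_derivative_near_cst _ _ _ _ _ C).
  by apply: filterS (open_nbhs_nbhs (conj openU Ux)).
exact: derivative_unique charD (dFG _ _ y'P) cst0 dx.
Qed.
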